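(* For $i=1,2$, let $G_i$ be an $r_i$-regular graph with $n_i$ vertices whose adjacency eigenvalues are $r_i=\lambda_1^{(i)}\ge\lambda_2^{(i)}\ge\cdots\ge\lambda_{n_i}^{(i)}$. Then the distance Laplacian spectrum of $G_1\nabla G_2$ consists of the eigenvalues $2n_1+n_2-r_1+\lambda_j^{(1)}$ for $j=2,\dots,n_1$, the eigenvalues $2n_2+n_1-r_2+\lambda_j^{(2)}$ for $j=2,\dots,n_2$, and the two eigenvalues $n_1+n_2$ and $0$.
   Context: For a connected graph $G$, $D(G)$ is the distance matrix, $Tr(G)$ the diagonal matrix of row sums of $D(G)$, and the distance Laplacian is $D^L(G)=Tr(G)-D(G)$. $G_1\nabla G_2$ (join) is obtained from the disjoint union of $G_1$ and $G_2$ by adding all edges between $V(G_1)$ and $V(G_2)$. *)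

(* Defs.v *)
From mathcomp Require Import all_boot all_order all_algebra.

Set Implicit Arguments.
Unset Strict Implicit.
Unset Printing Implicit Defensive.

Import Order.TTheory GRing.Theory Num.Theory.

Local Open Scope ring_scope.

Record sgraph := SGraph {
  vertex :> finType;
  adj : rel vertex;
  adj_sym : symmetric adj;
  adj_irrefl : irreflexive adj }.

Definition regular (G : sgraph) (r : nat) : Prop :=
  forall x : G, #|[set y | adj x y]| = r.

Definition connected (G : sgraph) : Prop :=
  forall x y : G, connect (@adj G) x y.

Section Join.
Variables G1 G2 : sgraph.

Definition join_adj (u v : G1 + G2) : bool :=
  match u, v with
  | inl x, inl y => adj x y
  | inr x, inr y => adj x y
  | _, _ => true
  end.

Lemma join_sym : symmetric join_adj.
Proof. by move=> [x|x] [y|y] //=; apply: adj_sym. Qed.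

Lemma join_irrefl : irreflexive join_adj.
Proof. by move=> [x|x] /=; apply: adj_irrefl. Qed.

Definition join : sgraph :=
  @SGraph (G1 + G2)%type join_adj join_sym join_irrefl.

Lemma join_connected : (0 < #|G1|)%N -> (0 < #|G2|)%N -> connected join.
Proof.
move=> /card_gt0P[a _] /card_gt0P[b _] [x|x] [y|y].
- by apply: (@connect_trans _ _ (inr b)); apply: connect1.
- exact: connect1.
- exact: connect1.
- by apply: (@connect_trans _ _ (inl a)); apply: connect1.
Qed.

End Join.

Definition walk_of_length (G : sgraph) (x y : G) (k : nat) : bool :=
  [exists p : k.-tuple G, path (@adj G) x p && (last x p == y)].

(* A shortest walk has fewer than #|G| edges, so the search below is exhaustive
   in a connected graph (see gdistP); the value for unreachable y is junk. *)
Definition gdist (G : sgraph) (x y : G) : nat :=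
  find (walk_of_length x y) (iota 0 #|G|).

Lemma gdistP (G : sgraph) (x y : G) : connect (@adj G) x y ->
  walk_of_length x y (gdist x y) /\
  (forall k, walk_of_length x y k -> (gdist x y <= k)%N).
Proof.
move=> /connectP[p0 p0P yE]; case/shortenP: p0P yE => p pP up _ yE.
have ltp : (size p < #|G|)%N by rewrite -[(size p).+1]/(size (x :: p)) -(card_uniqP up) max_card.
have wp : walk_of_length x y (size p).
  by apply/existsP; exists (in_tuple p); rewrite /= pP -yE eqxx.
have hasw : has (walk_of_length x y) (iota 0 #|G|).
  by apply/hasP; exists (size p); rewrite // mem_iota.
have ltd : (gdist x y < #|G|)%N by rewrite -[ltnRHS](size_iota 0) -has_find.
split; first by have := nth_find 0%N hasw; rewrite nth_iota.
move=> k wk; rewrite leqNgt; apply/negP => ltk.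
have := before_find 0%N ltk.
by rewrite nth_iota ?add0n ?wk // (ltn_trans ltk).
Qed.

Section Matrices.
Variables (R : nzRingType) (G : sgraph).

Definition adjmx : 'M[R]_#|G| :=
  \matrix_(i, j) (adj (enum_val i) (enum_val j))%:R.

Definition distmx : 'M[R]_#|G| :=
  \matrix_(i, j) (gdist (enum_val i) (enum_val j))%:R.

Definition transmx : 'M[R]_#|G| := diag_mx (\row_i \sum_j distmx i j).

Definition dist_laplacian : 'M[R]_#|G| := transmx - distmx.

End Matrices.

(* s lists the eigenvalues of M, each repeated according to its multiplicity
   as a root of the characteristic polynomial; the order of s is irrelevant. *)
Definition is_spectrum (R : comNzRingType) (n : nat) (M : 'M[R]_n) (s : seq R) :
  Prop := char_poly M = \prod_(x <- s) ('X - x%:P).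

(* Main.v *)
(* Ordering the vertices of the join as V(G1), V(G2), the distance Laplacian is
   diag(c1 + A1, c2 + A2) - U K U^T, where c1 = 2 n1 + n2 - r1,
   c2 = 2 n2 + n1 - r2, the two columns of U are the indicator vectors of V(G1)
   and V(G2), and K = [[2, 1], [1, 2]].  By regularity the column span of U is
   invariant under diag(c1 + A1, c2 + A2), so the perturbation only changes the
   part of the spectrum carried by this plane: the eigenvalues 2 n1 + n2 and
   2 n2 + n1 are replaced with those of a 2 x 2 matrix, which are n1 + n2 and
   0. *)
Require Import Defs.
From mathcomp Require Import all_boot all_order all_algebra.
From mathcomp Require Import perm ring.

Set Implicit Arguments.
Unset Strict Implicit.
Unset Printing Implicit Defensive.

Import Order.TTheory GRing.Theory Num.Theory.

Local Open Scope ring_scope.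

(** * Distances in graphs of diameter at most two *)

Lemma walk0E (G : sgraph) (x y : G) : walk_of_length x y 0 = (x == y).
Proof.
apply/existsP/eqP => [[p]|->]; first by rewrite tuple0 /= => /eqP.
by exists [tuple] => /=.
Qed.

Lemma walk1E (G : sgraph) (x y : G) : walk_of_length x y 1 = adj x y.
Proof.
apply/existsP/idP => [[p]|xy]; last by exists [tuple y]; rewrite /= xy eqxx.
by case/tupleP: p => z p; rewrite tuple0 /= andbT => /andP[xz /eqP <-].
Qed.

(** A common neighbour yields both the connectedness that [gdistP] requires and a walk of length 2;
    minimality then leaves the lengths 0, 1, 2, which equality and adjacency tell apart. *)
Lemma gdist_diam2 (G : sgraph) (x y : G) :
    (x != y -> ~~ adj x y -> exists z, adj x z && adj z y) ->
  gdist x y = ((x != y) * (2 - adj x y))%N.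
Proof.
move=> common.
have walk2 : x != y -> ~~ adj x y -> walk_of_length x y 2.
  move=> xy nxy; have [z /andP[xz zy]] := common xy nxy.
  by apply/existsP; exists [tuple z; y]; rewrite /= xz zy eqxx.
have cxy : connect (@adj G) x y.
  have [->//|xy] := eqVneq x y.
  have [/connect1//|nxy] := boolP (adj x y).
  have [z /andP[/connect1 xz /connect1]] := common xy nxy.
  exact: connect_trans.
have [wd mind] := gdistP cxy.
have [exy|xy] /= := eqVneq x y.
  by apply/eqP; rewrite -leqn0 mind // walk0E exy.
have d0 : gdist x y != 0%N.
  by apply: contra xy => /eqP d0; rewrite d0 walk0E in wd.
rewrite mul1n; have [axy|nxy] := boolP (adj x y).
  by apply/eqP; rewrite eqn_leq mind ?walk1E // lt0n.
apply/eqP; rewrite eqn_leq mind ?walk2 //=.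
have d1 : gdist x y != 1%N.
  by apply: contra nxy => /eqP d1; rewrite d1 walk1E in wd.
by case: (gdist x y) d0 d1 => [|[]].
Qed.

Lemma regular_sum_adj (R : nzRingType) (G : sgraph) (r : nat) (x : G) :
  regular G r -> \sum_y (adj x y)%:R = r%:R :> R.
Proof.
move=> /(_ x) <-; rewrite -sum1_card natr_sum [RHS]big_mkcond /=.
by apply: eq_bigr => y _; rewrite inE; case: adj.
Qed.

(** * The distance Laplacian of a join as a block matrix *)

Section JoinDistance.
Variables (R : comNzRingType) (G1 G2 : sgraph).
Hypotheses (G1_gt0 : (0 < #|G1|)%N) (G2_gt0 : (0 < #|G2|)%N).

(** Non-adjacent vertices lie on the same side, so any vertex of the other side, which is nonempty,
    is a common neighbour. In matrix form the distance matrix is 2J - 2I - A, with J the all-ones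
    matrix and A the adjacency matrix of the join. *)
Lemma gdist_join (u v : join G1 G2) :
  (gdist u v)%:R = 2 - 2 * (u == v)%:R - (adj u v)%:R :> R.
Proof.
rewrite gdist_diam2; last first.
  have /card_gt0P[a _] := G1_gt0; have /card_gt0P[b _] := G2_gt0.
  by case: u v => [x|x] [y|y] //= _ _; [exists (inr b) | exists (inl a)].
have [->|uv] := eqVneq u v.
  by rewrite adj_irrefl mul0n /= mulr1 subr0 subrr.
by rewrite mul1n mulr0 subr0 natrB //; case: adj.
Qed.

Lemma sum_gdist_join (u : join G1 G2) :
  \sum_(v : join G1 G2) (gdist u v)%:R
    = 2 * (#|G1|%:R + #|G2|%:R) - 2 - \sum_(v : join G1 G2) (adj u v)%:R :> R.
Proof.
rewrite (eq_bigr _ (fun v _ => gdist_join u v)) !sumrB; congr (_ - _ - _).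
  by rewrite sumr_const card_sum -natrD mulr_natr.
rewrite -mulr_sumr (bigD1 u) //= eqxx big1 ?addr0 ?mulr1 // => v.
by rewrite eq_sym => /negbTE ->.
Qed.

Lemma sum_adj_join_inl (r : nat) (x : G1) : regular G1 r ->
  \sum_(v : join G1 G2) (adj (inl x : join G1 G2) v)%:R = r%:R + #|G2|%:R :> R.
Proof.
by move=> reg; rewrite big_sumType /= (regular_sum_adj _ _ reg) sumr_const.
Qed.

Lemma sum_adj_join_inr (r : nat) (x : G2) : regular G2 r ->
  \sum_(v : join G1 G2) (adj (inr x : join G1 G2) v)%:R = #|G1|%:R + r%:R :> R.
Proof.
by move=> reg; rewrite big_sumType /= (regular_sum_adj _ _ reg) sumr_const.
Qed.

(** This order lists each side by its own enumeration, so that [adjmx R G1] and [adjmx R G2] appear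
    literally as diagonal blocks. *)
Definition join_vertex (i : 'I_(#|G1| + #|G2|)) : join G1 G2 :=
  match split i with inl a => inl (enum_val a) | inr b => inr (enum_val b) end.

Lemma join_vertex_inj : injective join_vertex.
Proof.
move=> i j; rewrite /join_vertex -{2}(splitK i) -{2}(splitK j).
by case: (split i) (split j) => [a|a] [b|b] // [] /enum_val_inj ->.
Qed.

Lemma join_vertex_lshift a : join_vertex (lshift _ a) = inl (enum_val a).
Proof. by rewrite /join_vertex (unsplitK (inl a)). Qed.

Lemma join_vertex_rshift b : join_vertex (rshift _ b) = inr (enum_val b).
Proof. by rewrite /join_vertex (unsplitK (inr b)). Qed.

Definition join_index (i : 'I_(#|G1| + #|G2|)) : 'I_#|join G1 G2| :=
  enum_rank (join_vertex i).

Lemma dist_laplacian_join_entry i j :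
  mxsub join_index join_index (dist_laplacian R (join G1 G2)) i j =
    (\sum_v (gdist (join_vertex i) v)%:R) *+ (i == j)
    - (gdist (join_vertex i) (join_vertex j))%:R.
Proof.
rewrite !mxE (inj_eq (inj_comp enum_rank_inj join_vertex_inj)) !enum_rankK.
congr (_ *+ _ - _); rewrite [RHS]big_enum_val /=.
by apply: eq_bigr => k _; rewrite !mxE enum_rankK.
Qed.

(** Degrees in the join are r1 + n2 on the first side and n1 + r2 on the second, so transmissions
    are constant on each side; the -2 they contain cancels against the -2I of the distance
    matrix. *)
Lemma dist_laplacian_join (r1 r2 : nat) : regular G1 r1 -> regular G2 r2 ->
  mxsub join_index join_index (dist_laplacian R (join G1 G2)) =
    block_mx
      (adjmx R G1 + (2 * #|G1|%:R + #|G2|%:R - r1%:R)%:M - const_mx 2)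
      (- const_mx 1) (- const_mx 1)
      (adjmx R G2 + (2 * #|G2|%:R + #|G1|%:R - r2%:R)%:M - const_mx 2).
Proof.
move=> reg1 reg2; apply/matrixP => i j.
rewrite dist_laplacian_join_entry gdist_join sum_gdist_join.
rewrite (inj_eq join_vertex_inj).
rewrite -[i]splitK -[j]splitK; case: (split i) (split j) => [a|a] [b|b] /=.
- rewrite !join_vertex_lshift block_mxEul !mxE (sum_adj_join_inl _ reg1) /=.
  by rewrite (inj_eq (@lshift_inj _ _)); case: eqP => _ /=; ring.
- rewrite join_vertex_lshift join_vertex_rshift block_mxEur !mxE eq_lrshift /=.
  by ring.
- rewrite join_vertex_lshift join_vertex_rshift block_mxEdl !mxE eq_rlshift /=.
  by ring.
- rewrite !join_vertex_rshift block_mxEdr !mxE (sum_adj_join_inr _ reg2) /=.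
  by rewrite (inj_eq (@rshift_inj _ _)); case: eqP => _ /=; ring.
Qed.

End JoinDistance.

(** * Characteristic polynomials under reindexing, shifts and low-rank updates *)

Lemma char_poly_mxsub (R : comNzRingType) (m n : nat) (f : 'I_m -> 'I_n)
    (M : 'M[R]_n) :
  m = n -> injective f -> char_poly (mxsub f f M) = char_poly M.
Proof.
move=> emn; case: n / emn f M => f M f_inj.
(* Once the sizes are identified, [f] is a permutation acting on rows and columns alike, so its sign
   occurs squared. *)
rewrite /char_poly (_ : char_poly_mx _ =
  row_perm (perm f_inj) (col_perm (perm f_inj) (char_poly_mx M))); last first.
  by apply/matrixP => i j; rewrite !mxE !permE (inj_eq f_inj).
rewrite row_permE col_permE !det_mulmx !det_perm odd_permV mulrCA -expr2.
by rewrite sqrr_sign mulr1.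
Qed.

Lemma char_poly_addC (R : comNzRingType) (n : nat) (A : 'M[R]_n) (c : R) :
  char_poly (A + c%:M) = char_poly A \Po ('X - c%:P).
Proof.
(* Substituting 'X - c for 'X is a ring morphism, hence commutes with the determinant. *)
rewrite /char_poly -[RHS]/(comp_poly _ _) -det_map_mx; congr (\det _).
apply/matrixP => i j; rewrite !mxE [RHS]comp_polyB comp_polyC.
rewrite polyCD polyCMn opprD addrA [LHS]addrAC; congr (_ - _).
by case: eqP; rewrite ?mulr1n ?mulr0n ?comp_polyX ?comp_poly0 ?subr0.
Qed.

(* Schur complements of [[B, - U], [V, 1]], and of its product with
   [[1, U], [0, C]]. *)
Lemma det_add_invariant (R : comNzRingType) (m n : nat) (B : 'M[R]_m)
    (U : 'M_(m, n)) (V : 'M_(n, m)) (C : 'M_n) :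
  B *m U = U *m C -> \det (B + U *m V) * \det C = \det B * \det (C + V *m U).
Proof.
move=> BU.
have eL : block_mx B (- U) V 1%:M *m block_mx 1%:M 0 (- V) 1%:M
    = block_mx (B + U *m V) (- U) 0 1%:M.
  rewrite mulmx_block !mulmx1 !mulmx0 !mul1mx mulNmx mulmxN opprK.
  by rewrite subrr !add0r.
have eR : block_mx B (- U) V 1%:M *m block_mx 1%:M U 0 C
    = block_mx B 0 V (C + V *m U).
  rewrite mulmx_block !mulmx1 !mulmx0 mul1mx mulNmx BU subrr !addr0.
  by rewrite [V *m U + C]addrC.
have := congr1 determinant eL; have := congr1 determinant eR.
rewrite !det_mulmx det_lblock !det_ublock det_lblock !det1 !mulr1 !mul1r.
by move=> <- <-.
Qed.

Lemma adjmx_const (R : comNzRingType) (G : sgraph) (r : nat) : regular G r ->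
  adjmx R G *m const_mx 1 = r%:R *: const_mx 1 :> 'cV_#|G|.
Proof.
move=> reg; apply/matrixP => i j; rewrite !mxE mulr1.
rewrite -(regular_sum_adj R (enum_val i) reg) [RHS]big_enum_val /=.
by apply: eq_bigr => k _; rewrite !mxE mulr1.
Qed.

Lemma mul_const_mx (R : pzSemiRingType) (m n p : nat) (x y : R) :
  (const_mx x : 'M_(m, n)) *m (const_mx y : 'M_(n, p)) = const_mx (x * y *+ n).
Proof.
apply/matrixP => i j; rewrite !mxE.
by under eq_bigr do rewrite !mxE; rewrite sumr_const card_ord.
Qed.

Lemma char_poly_mx_eigen (R : comNzRingType) (n : nat) (A : 'M[R]_n) (a : R) :
  A *m const_mx 1 = a *: const_mx 1 :> 'cV_n ->
  char_poly_mx A *m const_mx 1 = const_mx ('X - a%:P) :> 'cV_n.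
Proof.
move=> Aa; rewrite mulmxBl mul_scalar_mx.
have -> : const_mx 1 = map_mx (@polyC R) (const_mx 1) :> 'cV_n.
  by apply/matrixP => i j; rewrite !mxE.
by rewrite -map_mxM Aa; apply/matrixP => i j; rewrite !mxE !mulr1.
Qed.

Lemma det_block_mx11 (R : comNzRingType) (a b c d : 'M[R]_1) :
  \det (block_mx a b c d) = a 0 0 * d 0 0 - b 0 0 * c 0 0.
Proof.
rewrite (expand_det_row _ (lshift 1 ord0)) big_split_ord /= !big_ord1.
rewrite block_mxEul block_mxEur /cofactor !det_mx11 !mxE.
have -> : @lift (1 + 1) (lshift 1 ord0) 0 = rshift 1 ord0 by apply: val_inj.
have -> : @lift (1 + 1) (rshift 1 ord0) 0 = lshift 1 ord0 by apply: val_inj.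
rewrite (unsplitK (inr ord0)) row_mxEl row_mxEr /= expr0 expr1.
by rewrite mul1r mulN1r mulrN.
Qed.

(** The characteristic matrix is D + U V, and the span of the columns of U is D-invariant with
    action C. Both sides keep the factor det C = ('X - a)('X - b), as [R] is an arbitrary
    commutative ring; the last factor is det (C + V U), where V U = [[2m, n], [m, 2n]]. *)
Lemma char_poly_block_const (R : comNzRingType) (m n : nat) (A : 'M[R]_m)
    (B : 'M[R]_n) (a b : R) :
    A *m const_mx 1 = a *: const_mx 1 :> 'cV_m ->
    B *m const_mx 1 = b *: const_mx 1 :> 'cV_n ->
  char_poly (block_mx (A - const_mx 2) (- const_mx 1) (- const_mx 1)
                      (B - const_mx 2)) * (('X - a%:P) * ('X - b%:P)) =
  char_poly A * char_poly B
  * (('X - a%:P + 2 * m%:R) * ('X - b%:P + 2 * n%:R) - m%:R * n%:R).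
Proof.
move=> Aa Bb.
pose D : 'M[{poly R}]_(m + n) := block_mx (char_poly_mx A) 0 0 (char_poly_mx B).
pose U : 'M[{poly R}]_(m + n, 1 + 1) := block_mx (const_mx 1) 0 0 (const_mx 1).
pose V : 'M[{poly R}]_(1 + 1, m + n) :=
  block_mx (const_mx 2) (const_mx 1) (const_mx 1) (const_mx 2).
pose C : 'M[{poly R}]_(1 + 1) :=
  block_mx ('X - a%:P)%:M 0 0 ('X - b%:P)%:M.
have DU : D *m U = U *m C.
  rewrite !mulmx_block !mulmx0 !mul0mx !addr0 !add0r !mul_mx_scalar.
  rewrite (char_poly_mx_eigen Aa) (char_poly_mx_eigen Bb).
  by congr (block_mx _ 0 0 _); apply/matrixP => i j; rewrite !mxE mulr1.
have := det_add_invariant V DU.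
rewrite !det_ublock !det_scalar1 /C /V /U !mulmx_block !add_block_mx.
rewrite det_block_mx11 !mulmx0 !mul0mx !mul_const_mx !addr0 !add0r !mxE.
rewrite !mulr1n !mul1r !mulr1 -[2 *+ m]mulr_natr -[2 *+ n]mulr_natr.
rewrite [n%:R * m%:R]mulrC => <-; congr (\det _ * _).
rewrite /char_poly_mx map_block_mx scalar_mx_block opp_block_mx add_block_mx.
rewrite !map_mxB !map_mxN !map_const_mx !opprB !opprK !add0r.
by rewrite /= polyC1 polyC_natr ![const_mx _ - _]addrC !addrA.
Qed.

Lemma is_spectrum_addC (R : comNzRingType) (n : nat) (M : 'M[R]_n) (s : seq R)
    (c : R) :
  is_spectrum M s -> is_spectrum (M + c%:M) [seq c + x | x <- s].
Proof.
rewrite /is_spectrum char_poly_addC => ->.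
rewrite -[LHS]/(comp_poly _ _) rmorph_prod big_map; apply: eq_bigr => x _ /=.
by rewrite comp_polyB comp_polyX comp_polyC polyCD opprD addrA.
Qed.

Lemma behead_head (T : Type) (x0 x : T) (s : seq T) :
  (0 < size s)%N -> head x0 s = x -> s = x :: behead s.
Proof. by case: s => //= y s _ ->. Qed.

Theorem theorem3p1 (R : rcfType) (G1 G2 : sgraph) (n1 n2 r1 r2 : nat)
    (lambda1 : n1.-tuple R) (lambda2 : n2.-tuple R) :
  (0 < n1)%N -> (0 < n2)%N ->
  #|G1| = n1 -> #|G2| = n2 ->
  regular G1 r1 -> regular G2 r2 ->
  is_spectrum (adjmx R G1) lambda1 -> is_spectrum (adjmx R G2) lambda2 ->
  sorted >=%R lambda1 -> sorted >=%R lambda2 ->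
  head 0 lambda1 = r1%:R -> head 0 lambda2 = r2%:R ->
  is_spectrum (dist_laplacian R (join G1 G2))
    ([seq 2 * n1%:R + n2%:R - r1%:R + x | x <- behead lambda1]
     ++ [seq 2 * n2%:R + n1%:R - r2%:R + x | x <- behead lambda2]
     ++ [:: n1%:R + n2%:R; 0]).
Proof.
move=> G1_gt0 G2_gt0 cardG1 cardG2; subst n1 n2.
move=> reg1 reg2 spec1 spec2 _ _ head1 head2.
have := dist_laplacian_join R G1_gt0 G2_gt0 reg1 reg2.
set c1 := _ - r1%:R; set c2 := _ - r2%:R => eL.
have eigen (G : sgraph) (r : nat) (c : R) : regular G r ->
    (adjmx R G + c%:M) *m const_mx 1 = (c + r%:R) *: const_mx 1 :> 'cV_#|G|.
  move=> reg; rewrite mulmxDl (adjmx_const _ reg) mul_scalar_mx -scalerDl.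
  by rewrite addrC.
have := char_poly_block_const (eigen _ _ c1 reg1) (eigen _ _ c2 reg2).
rewrite -eL char_poly_mxsub; last 2 first.
- by rewrite card_sum.
- exact: inj_comp enum_rank_inj (@join_vertex_inj _ _).
have := is_spectrum_addC c1 spec1.
have := is_spectrum_addC c2 spec2.
rewrite /is_spectrum => -> ->.
(* Splitting off the heads isolates the factors 'X - (c_i + r_i) carried by the all-ones vectors. *)
rewrite (behead_head _ head1) ?size_tuple //.
rewrite (behead_head _ head2) ?size_tuple //.
rewrite /= !big_cons !big_cat /= big_cons big_seq1.
set p1 := \prod_(_ <- _) _; set p2 := \prod_(_ <- _) _ => eD.
(* Over a field these linear factors are nonzero and cancel. *)
apply: (@mulIf _ (('X - (c1 + r1%:R)%:P) * ('X - (c2 + r2%:R)%:P))).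
  by rewrite mulf_neq0 // polyXsubC_eq0.
(* Now c1 + r1 = 2 n1 + n2 and c2 + r2 = 2 n2 + n1, so the quadratic factor is ('X - n2)('X - n1) -
   n1 n2 = 'X ('X - n1 - n2), giving the eigenvalues n1 + n2 and 0. *)
rewrite eD /c1 /c2 !subrK.
rewrite !(polyCD, polyCM, polyC_natr, polyC0).
ring.
Qed.
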